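(* Let $e : X \to Y$ be a compactification of a completely regular space $X$ and $e^\flat : C(Y) \to B(X)$, $e^\flat(f)=f\circ e$, the corresponding basic extension. Then $X$ is Lindelöf iff $e^\flat$ satisfies (L): whenever $S,T\subseteq C(Y)$ and $\varepsilon>0$ are such that $\bigwedge e^\flat[S] + \varepsilon \le \bigvee e^\flat[T]$, there are countable subsets $S' \subseteq S$ and $T'\subseteq T$ with $\bigwedge e^\flat[S'] \le \bigvee e^\flat[T']$.
   Context: Completely regular spaces are Hausdorff. A compactification of a completely regular space $X$ is a topological embedding $e:X\to Y$ into a compact Hausdorff space $Y$ with $e[X]$ dense in $Y$. $C(Y)$ is the $\ell$-algebra (lattice-ordered $\mathbb R$-algebra) of continuous real-valued functions on $Y$, and $B(X)$ the $\ell$-algebra of all bounded real-valued functions on $X$, with pointwise operations and order. Real numbers are identified with constant functions. Joins and meets in the formulas are taken in $B(X)$ and are presupposed to exist there. A completely regular space $X$ is Lindelöf if each open cover of $X$ has a countable subcover. *)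

(* Defs.v *)
From HB Require Import structures.
From mathcomp Require Import all_boot all_order all_algebra.
From mathcomp Require Import all_classical all_reals all_analysis.

Set Implicit Arguments.
Unset Strict Implicit.
Unset Printing Implicit Defensive.
Import Order.TTheory GRing.Theory Num.Theory.
Import numFieldNormedType.Exports.
Local Open Scope classical_set_scope.
Local Open Scope ring_scope.

Definition lindelof_space (X : topologicalType) : Prop :=
  forall U : set (set X), U `<=` open -> \bigcup_(A in U) A = [set: X] ->
  exists V : set (set X),
    [/\ V `<=` U, countable V & \bigcup_(A in V) A = [set: X]].

(* A homeomorphism onto the subspace [range e] of [Y]. *)
Definition topological_embedding (X Y : topologicalType) (e : X -> Y) : Prop :=
  [/\ injective e, continuous e &
      forall U : set X, open U ->
        exists2 V : set Y, open V & e @` U = V `&` range e].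

Record compactification (X Y : topologicalType) := Compactification {
  compactification_map :> X -> Y;
  compactification_compact : compact [set: Y];
  compactification_hausdorff : hausdorff_space Y;
  compactification_embedding : topological_embedding compactification_map;
  compactification_dense : dense (range compactification_map) }.

Section BoundedFunctions.
Variables (X : Type) (R : realType).

Definition bounded_fun_pred : {pred X -> R} :=
  [pred f : X -> R | `[< bounded_fun f >]].

Record bfun : Type := BFun {
  bfun_val :> X -> R;
  _ : bfun_val \in bounded_fun_pred }.

HB.instance Definition _ := [isSub for bfun_val].
HB.instance Definition _ := [Choice of bfun by <:].

Lemma bounded_fun_zmod_closed : zmod_closed bounded_fun_pred.
Proof.
split=> [|f g /asboolP f_bnd /asboolP g_bnd]; apply/asboolP; last first.
  exact: (bounded_funD f_bnd (bounded_funN g_bnd)).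
exact: (bounded_cst (0 : R)).
Qed.

HB.instance Definition _ :=
  GRing.isZmodClosed.Build (X -> R) bounded_fun_pred bounded_fun_zmod_closed.
HB.instance Definition _ := [SubChoice_isSubZmodule of bfun by <:].
HB.instance Definition _ := [SubChoice_isSubPOrder of bfun by <: with FunOrder.fun_display].

Lemma cst_bounded (a : R) : cst a \in bounded_fun_pred.
Proof. by apply/asboolP; exact: bounded_cst. Qed.

Definition bfun_cst (a : R) : bfun := BFun (cst_bounded a).

End BoundedFunctions.

Section Flat.
Variables (X Y : topologicalType) (R : realType) (e : compactification X Y).

Lemma flat_bounded (f : continuousType Y R) :
  (f : Y -> R) \o e \in @bounded_fun_pred X R.
Proof.
apply/asboolP.
have /compact_bounded [M [Mr fM]] : compact (range f).
  apply: continuous_compact (compactification_compact e).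
  exact/continuous_subspaceT/cts_fun.
by exists M; split=> // N MN x _ /=; apply: (fM N MN); exists (e x).
Qed.

Definition flat (f : continuousType Y R) : bfun X R := BFun (flat_bounded f).

End Flat.

(* Since [B(X)] is not a complete lattice, each meet or join that occurs in (L)
   is required to exist, also those of the countable subsets [S'] and [T'];
   in particular [S'] and [T'] cannot be empty unless [X] is. *)
Definition condition_L (X A : Type) (R : realType) (alpha : A -> bfun X R) :
    Prop :=
  forall (S T : set A) (eps : R) (s t : bfun X R), 0 < eps ->
  infimums (alpha @` S) s -> supremums (alpha @` T) t ->
  (s + bfun_cst X eps <= t)%O ->
  exists S' T' : set A,
    [/\ S' `<=` S, countable S', T' `<=` T, countable T' &
        exists s' t' : bfun X R,
          [/\ infimums (alpha @` S') s', supremums (alpha @` T') t' &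
              (s' <= t')%O]].

(* Main.v *)
(** In B(X) the supremum of a nonempty family that is bounded above is its
    pointwise supremum, and dually for infima.  If X is Lindelöf, a strict gap
    between the meet of S and the join of T yields, at each point x of X, some
    f in S and g in T with f (e x) < g (e x); the open sets where such
    inequalities hold cover X, and a countable subcover gives S' and T'.
    Conversely, given an open cover of X, apply (L) to S = {1/2} and to the set
    T of all continuous functions on Y with values in [0, 1] whose restriction
    to X vanishes outside a member of the cover: Urysohn's lemma in Y shows that
    T has join 1, and the members of the cover chosen for a countable T' with
    join at least 1/2 already cover X. *)
Require Import Defs.
From HB Require Import structures.
From mathcomp Require Import all_boot all_order all_algebra.
From mathcomp Require Import all_classical all_reals all_analysis.
Import numFieldNormedType.Exports.

Set Implicit Arguments.
Unset Strict Implicit.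
Unset Printing Implicit Defensive.
Import Order.TTheory GRing.Theory Num.Theory.
Local Open Scope classical_set_scope.
Local Open Scope ring_scope.

Section BoundedFunctions.
Variables (X : Type) (R : realType).
Implicit Types (f g s t : bfun X R) (F : set (bfun X R)).

Lemma bounded_fun_predP (h : X -> R) :
  reflect (exists M, forall x, `|h x| <= M) (h \in @bounded_fun_pred X R).
Proof.
apply: (iffP (asboolP _)) => [[M [_ hM]]|[M hM]].
  by exists (M + 1) => x; apply: hM => //; rewrite ltrDl.
exists M; split=> [|N MN x _ /=]; first exact: num_real.
exact: le_trans (hM x) (ltW MN).
Qed.

Lemma bfun_leP f g : reflect (forall x, f x <= g x) (f <= g)%O.
Proof. exact: asboolP. Qed.

Lemma bfun_leN2 f g : (- f <= - g)%O = (g <= f)%O.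
Proof.
by apply/bfun_leP/bfun_leP => gf x; have := gf x; rewrite lerN2.
Qed.

(** Negation is an order-reversing involution of [bfun X R]; this reduces facts on meets to facts on
    joins. *)
Lemma supremumsN F s : infimums F s <-> supremums (-%R @` F) (- s).
Proof.
have lbN h : lbound F h <-> ubound (-%R @` F) (- h).
  split=> [Fh _ [f Ff <-]|Fh f Ff]; first by rewrite bfun_leN2; exact: Fh.
  by rewrite -bfun_leN2; apply: Fh; exists f.
split=> -[/lbN sF s_max]; split=> // h.
  rewrite -[h]opprK bfun_leN2 => /lbN; exact: s_max.
by move/lbN/s_max; rewrite bfun_leN2.
Qed.

(** Otherwise lowering [t] to the value [a] at the single point [x] would give a bounded function
    that is still an upper bound of [F], but not above [t]. *)
Lemma supremums_gt F t x a : supremums F t -> a < t x ->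
  exists2 f, F f & a < f x.
Proof.
move=> [tF t_min] at_; apply: contrapT => F_le_a.
pose h y := if pselect (y = x) is left _ then a else t y.
have hP : h \in @bounded_fun_pred X R.
  have /bounded_fun_predP[M tM] := valP t.
  apply/bounded_fun_predP; exists (Num.max `|a| M) => y; rewrite /h.
  by case: pselect => _; rewrite le_max ?lexx// tM orbT.
have /bfun_leP/(_ x) : (t <= BFun hP)%O.
  apply: t_min => f Ff; apply/bfun_leP => y /=; rewrite /h.
  case: pselect => [->|_]; last exact/bfun_leP/tF.
  by rewrite leNgt; apply/negP => af; apply: F_le_a; exists f.
by rewrite /= /h; case: pselect => // _; rewrite leNgt at_.
Qed.

Lemma infimums_lt F s x a : infimums F s -> s x < a ->
  exists2 f, F f & f x < a.
Proof.
move=> /supremumsN sF sa; have : - a < (- s) x by rewrite ltrN2.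
by move=> /(supremums_gt sF)[_ [f Ff <-]]; rewrite ltrN2; exists f.
Qed.

(** The pointwise supremum is bounded: a member [f0] of [F] bounds it below and an upper bound [g]
    bounds it above. *)
Lemma supremums_exists F : F !=set0 -> ubound F !=set0 ->
  exists t, supremums F t.
Proof.
move=> [f0 Ff0] [g gF].
pose E x := [set f x | f in F]; pose h x := sup (E x).
have E0 x : E x !=set0 by exists (f0 x), f0.
have Eg x : ubound (E x) (g x) by move=> _ [f Ff <-]; exact/bfun_leP/gF.
have Eh f x : F f -> f x <= h x.
  by move=> Ff; apply: ub_le_sup; [exists (g x)|exists f].
have hP : h \in @bounded_fun_pred X R.
  have /bounded_fun_predP[M f0M] := valP f0.
  have /bounded_fun_predP[N gN] := valP g.
  apply/bounded_fun_predP; exists (Num.max M N) => x.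
  rewrite ler_norml lerNl; apply/andP; split; rewrite le_max.
    rewrite (le_trans _ (f0M x))// ler_normr.
    by rewrite lerN2 Eh ?orbT.
  by rewrite (le_trans (ge_sup (E0 x) (Eg x)) (ler_normlW (gN x))) orbT.
exists (BFun hP); split=> [f Ff|k kF]; apply/bfun_leP => x; first exact: Eh.
by apply: ge_sup => // _ [f Ff <-]; exact/bfun_leP/kF.
Qed.

Lemma infimums_exists F : F !=set0 -> lbound F !=set0 ->
  exists s, infimums F s.
Proof.
move=> [f Ff] [g gF]; have [||t tF] := @supremums_exists (-%R @` F).
- by exists (- f), f.
- by exists (- g) => _ [h Fh <-]; rewrite bfun_leN2; exact: gF.
- by exists (- t); apply/supremumsN; rewrite opprK.
Qed.

End BoundedFunctions.

(** Indexing the countable subcover by points lets data chosen for each point be restricted to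
    countably many of them. *)
Lemma lindelof_pointed_cover (X : topologicalType) (W : X -> set X) :
  lindelof_space X -> (forall x, open (W x)) -> (forall x, W x x) ->
  exists2 D : set X, countable D & forall y, exists2 x, D x & W x y.
Proof.
move=> lX oW Wxx.
have [x0|X0] := pselect (inhabited X); last first.
  by exists set0 => [|y]; [exact: countable0|case: X0].
have [||V [VW cV Vcov]] := lX (range W).
- by move=> _ [x _ <-].
- by apply/seteqP; split=> // x _; exists (W x).
(* Outside [range W] the value of [k] is the dummy point [x0]. *)
have /choice[k kP] : forall A, exists x, range W A -> W x = A.
  move=> A; have [[x _ WxA]|nA] := pselect (range W A); first by exists x.
  by case: x0 => x0; exists x0.
exists (k @` V) => [|y]; first exact: card_le_trans (card_image_le _ _) cV.
have : [set: X] y by [].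
rewrite -Vcov => -[A VA Ay]; exists (k A); first by exists A.
by rewrite kP //; exact: VW.
Qed.

Lemma urysohn_point (R : realType) (Y : topologicalType) (V : set Y) (y : Y) :
  compact [set: Y] -> hausdorff_space Y -> open V -> V y ->
  exists f : continuousType Y R,
    [/\ forall z, 0 <= f z <= 1, f y = 1 & forall z, ~ V z -> f z = 0].
Proof.
move=> cY hY oV Vy.
have nY : normal_space Y by exact: compact_normal.
have crY : completely_regular_space Y.
  exact: (normal_completely_regular (R := R)) nY (hausdorff_accessible hY).
have /(@uniform_separatorP _ R)[f [cf f01 fy fV]] :
  uniform_separator [set y] (~` V) by apply: crY; [exact: open_closedC|exact].
(* The separator is 0 at [y] and 1 off [V], the reverse of what is wanted. *)
have cg : continuous (fun z => 1 - f z).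
  by move=> z; apply: cvgB; [exact: cvg_cst|exact: cf].
exists (mkcts cg); split=> [z||z nVz] /=; rewrite /mkcts.
- have : f z \in `[0, 1] by apply: f01; exists z.
  by rewrite in_itv /= subr_ge0 lerBlDr lerDl andbC.
- by rewrite (_ : f y = 0) ?subr0//; apply: fy; exists y.
- by rewrite (_ : f z = 1) ?subrr//; apply: fV; exists z.
Qed.

Section Compactification.
Variables (R : realType) (X Y : topologicalType) (e : compactification X Y).

Lemma lindelof_condition_L : lindelof_space X -> condition_L (flat (R := R) e).
Proof.
move=> lX S T eps s t eps0 sS tT st.
(* Over an empty [X] all bounded functions are equal, so even the empty family has a meet and a
   join. *)
have [[x0]|X0] := pselect (inhabited X); last first.
  have bfun_le (f g : bfun X R) : (f <= g)%O.
    by apply/bfun_leP => x; case: X0.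
  exists set0, set0; split=> //; exists s, t; split=> //;
    by split=> f _; exact: bfun_le.
have /choice[p pP] : forall x, exists
    fg : continuousType Y R * continuousType Y R,
    [/\ S fg.1, T fg.2 & fg.1 (e x) < fg.2 (e x)].
  move=> x; have stx : s x < t x.
    by have /bfun_leP/(_ x) := st; apply: lt_le_trans; rewrite /= ltrDl.
  (* The midpoint of [s x] and [t x] separates [f (e x)] from [g (e x)]. *)
  have [_ [f Sf <-] fst] := infimums_lt sS (midf_lt stx).1.
  have [_ [g Tg <-] tg] := supremums_gt tT (midf_lt stx).2.
  by exists (f, g); split=> //; exact: lt_trans fst tg.
pose W x := [set y | (p x).1 (e y) < (p x).2 (e y)].
have [_ ce _] := compactification_embedding e.
have oW x : open (W x).
  have -> : W x = (fun y => (p x).2 (e y) - (p x).1 (e y)) @^-1` [set r | 0 < r].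
    by apply/seteqP; split=> y; rewrite /W /= subr_gt0.
  apply: open_comp; last exact: open_gt.
  move=> y _; apply: cvgB; apply: (continuous_comp (ce y)); exact: cts_fun.
have [|D cD DW] := lindelof_pointed_cover lX oW.
  by move=> x; have [] := pP x.
(* The point [d] makes [S'] and [T'] nonempty, so that their meet and join exist. *)
have [d Dd _] := DW x0.
pose S' := [set (p x).1 | x in D]; pose T' := [set (p x).2 | x in D].
have S'S : S' `<=` S by move=> _ [x _ <-]; have [] := pP x.
have T'T : T' `<=` T by move=> _ [x _ <-]; have [] := pP x.
have [||s' s'S'] := @infimums_exists X R (flat e @` S').
- by exists (flat e (p d).1), (p d).1 => //; exists d.
- by exists s => _ [f /S'S Sf <-]; apply: sS.1; exists f.
have [||t' t'T'] := @supremums_exists X R (flat e @` T').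
- by exists (flat e (p d).2), (p d).2 => //; exists d.
- by exists t => _ [f /T'T Tf <-]; apply: tT.1; exists f.
exists S', T'; split=> //; try exact: card_le_trans (card_image_le _ _) cD.
exists s', t'; split=> //; apply/bfun_leP => y.
have [x Dx Wxy] := DW y.
have /bfun_leP/(_ y) s'p : (s' <= flat e (p x).1)%O.
  by apply: s'S'.1; exists (p x).1 => //; exists x.
have /bfun_leP/(_ y) pt' : (flat e (p x).2 <= t')%O.
  by apply: t'T'.1; exists (p x).2 => //; exists x.
exact: le_trans s'p (le_trans (ltW Wxy) pt').
Qed.

Lemma condition_L_lindelof : condition_L (flat (R := R) e) -> lindelof_space X.
Proof.
move=> L U oU Ucov.
pose vanishes_off (f : continuousType Y R) A := forall x, ~ A x -> f (e x) = 0.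
pose T := [set f : continuousType Y R | (forall y, f y <= 1) /\
  exists2 A, U A & vanishes_off f A].
have [c cE] : exists c : continuousType Y R, flat e c = bfun_cst X 2^-1.
  have half : continuous (fun _ : Y => 2^-1 : R) by move=> y; exact: cvg_cst.
  by exists (mkcts half); exact/val_inj.
have [||||S' [T' [S'c _ T'T cT' [s' [t' [s'S' t'T' st']]]]]] :=
  L [set c] T 2^-1 (bfun_cst X 2^-1) (bfun_cst X 1).
- by rewrite invr_gt0.
- by rewrite classical_sets.image_set1 cE infimums1.
- split=> [_ [f [f1 _] <-]|h hT]; apply/bfun_leP => x /=; first exact: f1.
  have [A UA Ax] : (\bigcup_(A in U) A) x by rewrite Ucov.
  (* As [e] is an embedding, [A] is the trace on [X] of an open [V] in [Y]; a Urysohn function for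
     [V] at [e x] then vanishes off [A] and is 1 at [x]. *)
  have [_ _ /(_ A (oU A UA))[V oV AV]] := compactification_embedding e.
  have Vex : V (e x).
    by have [] : (V `&` range e) (e x) by rewrite -AV; exists x.
  have [f [f01 fx fV]] := urysohn_point R
    (compactification_compact e) (compactification_hausdorff e) oV Vex.
  rewrite -fx; apply/(bfun_leP (flat e f) h); apply: hT; exists f => //.
  split=> [y|]; first by have /andP[] := f01 y.
  exists A => // z nAz; apply: fV => Vez.
  have : (V `&` range e) (e z) by split=> //; exists z.
  rewrite -AV => -[w Aw]; have [inj_e _ _] := compactification_embedding e.
  by move/inj_e => wz; apply: nAz; rewrite -wz.
- by apply/bfun_leP => x /=; rewrite [leRHS]splitr !mul1r.
(* A countable [T'] yields countably many sets once each [f] in [T] is assigned one member of the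
   cover; [set0] is a dummy outside [T]. *)
have /choice[k kP] : forall f, exists A, T f -> U A /\ vanishes_off f A.
  by move=> f; have [[_ [A UA fA]]|nTf] := pselect (T f); [exists A|exists set0].
exists (k @` T'); split.
- by move=> _ [f /T'T/kP[Ukf _] <-].
- exact: card_le_trans (card_image_le _ _) cT'.
apply/seteqP; split=> // x _.
(* Whether [S'] is empty or [[set c]], the constant 1/2 is a lower bound of its image. *)
have s'x : 2^-1 <= s' x.
  have /bfun_leP/(_ x) : (bfun_cst X 2^-1 <= s')%O; last by [].
  by apply: s'S'.2 => _ [f /S'c -> <-]; rewrite cE.
have t'x : 0 < t' x.
  have /bfun_leP/(_ x) := st'; apply: lt_le_trans.
  by apply: lt_le_trans s'x; rewrite invr_gt0.
(* Some [f] in [T'] is positive at [e x]; since it vanishes off [k f], the point [x] lies in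
   [k f]. *)
have [_ [f T'f <-] fx] := supremums_gt t'T' t'x.
exists (k f); first by exists f.
apply: contrapT => nkfx; have [_ /(_ x nkfx) f0] := kP f (T'T f T'f).
by move: fx; rewrite /= f0 ltxx.
Qed.

End Compactification.

Theorem theorem4p11 (R : realType) (X Y : topologicalType)
    (crX : completely_regular_space X) (hX : hausdorff_space X)
    (e : compactification X Y) :
  lindelof_space X <-> condition_L (flat (R := R) e).
Proof. by split; [exact: lindelof_condition_L|exact: condition_L_lindelof]. Qed.
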